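(* Let $H$ be an $r$-graph with $m(H) \le a/b$ for some $a, b \in \mathbb{N}$ with $b > r-1$ and $a > b/(r-1)$. Let $D$ denote the maximum degree of $H$. Then there exists a family of graphs (that is, $2$-graphs) $H_1, \ldots, H_a$ on the vertex set $V(H)$ such that the following holds: (D1) for every $i \in \{1,\dots,a\}$, each connected component of $H_i$ contains at most one cycle, and the maximum degree of $H_i$ is at most $2D$; and (D2) for each hyperedge $h \in E(H)$ there exist forests $F_1^{(h)} \subseteq H_1, \ldots, F_a^{(h)} \subseteq H_a$, each on the vertex set $h$ (an $r$-element subset of $V(H)$), such that $\sum_{i=1}^a e(F_i^{(h)}) = b$.
   Context: An $r$-graph ($r \ge 2$) is a finite $r$-uniform hypergraph, i.e. its hyperedges form a set of $r$-element subsets of the vertex set. For a hypergraph $H$, $v(H)$ and $e(H)$ denote its numbers of vertices and hyperedges, the degree of a vertex is the number of hyperedges containing it, and the maximal density of $H$ is $$m(H) = \max_{H' \subseteq H} \frac{e(H')}{v(H')},$$ where the maximum is over all subgraphs $H'$ of $H$ with at least one vertex. The notation $F_i^{(h)} \subseteq H_i$ means that $F_i^{(h)}$ is a graph with vertex set $h$ all of whose edges are edges of $H_i$. *)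

(* Defs.v *)
From HB Require Import structures.
From mathcomp Require Import all_boot all_order all_algebra.

Set Implicit Arguments.
Unset Strict Implicit.
Unset Printing Implicit Defensive.

Import Order.TTheory GRing.Theory Num.Theory.

Section Hypergraphs.
Variable T : finType.

(* A hypergraph carries its own vertex set inside the ambient type T, so that
   subgraphs, components and graphs on a hyperedge live in the same type. *)
Definition wf_hypergraph (P : {set T} * {set {set T}}) : bool :=
  [forall h in P.2, h \subset P.1].

Record hypergraph := Hypergraph {
  hgval :> {set T} * {set {set T}};
  hgvalP : wf_hypergraph hgval
}.

HB.instance Definition _ := [isSub for hgval].
HB.instance Definition _ := [Finite of hypergraph by <:].

Implicit Types (G H K C : hypergraph) (W h : {set T}) (x y v : T).

Definition vset H : {set T} := H.1.
Definition edges H : {set {set T}} := H.2.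

Definition uniform (r : nat) H : bool := [forall h in edges H, #|h| == r].

Definition subgraph K H : bool :=
  (vset K \subset vset H) && (edges K \subset edges H).

Definition degree H v : nat := #|[set h in edges H | v \in h]|.

Definition max_degree H : nat := \max_(v in vset H) degree H v.

(* All the densities are nonnegative, so the default value 0 only matters
   when H has no vertex. *)
Definition max_density H : rat :=
  \big[Num.max/0%R]_(K : hypergraph | subgraph K H && (vset K != set0))
    (#|edges K|%:R / #|vset K|%:R)%R.

Lemma induced_wf H W :
  wf_hypergraph (vset H :&: W, [set h in edges H | h \subset W]).
Proof.
apply/forall_inP => h; rewrite inE /= => /andP[hH hW].
by rewrite subsetI hW andbT; apply: (forall_inP (hgvalP H)).
Qed.

Definition induced H W : hypergraph := Hypergraph (induced_wf H W).

(* The notions below are meant for 2-uniform hypergraphs. *)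

Definition adj G : rel T := [rel x y | (x != y) && ([set x; y] \in edges G)].

Definition is_component G K : Prop :=
  exists2 x, x \in vset G & K = induced G [set y | connect (adj G) x y].

Definition is_cycle C : Prop :=
  exists c : seq T,
    [/\ uniq c, 2 < size c, vset C = [set x in c]
      & edges C = [set [set x; next c x] | x in c]].

Definition at_most_one_cycle G : Prop :=
  forall C1 C2, is_cycle C1 -> subgraph C1 G ->
    is_cycle C2 -> subgraph C2 G -> C1 = C2.

Definition is_forest G : Prop :=
  uniform 2 G /\ forall C, is_cycle C -> ~~ subgraph C G.

End Hypergraphs.

(* Main.v *)
Require Import Defs.
From mathcomp Require Import all_boot all_order all_algebra.
From mathcomp Require Import zify.

(** Every hyperedge h chooses a set S h i of its vertices for each colour i, so
    that the choices of distinct hyperedges in one colour are disjoint, h makes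
    b choices in total, and S h i is never all of h ([capped_choice]).  In
    colour i, arrange S h i followed by one further vertex of h as a path, and
    let F h i be that path: it is a forest on h with #|S h i| edges, and H_i is
    the union of the paths of colour i.

    Orient every path forwards.  The start of an arc of F h i lies in S h i, so
    by disjointness each vertex starts at most one arc of H_i: the graph H_i is
    the graph of a self-map phi of the vertices, fixed points giving no edge.
    A cycle in such a graph is traversed by phi in one direction
    ([fgraph_cycle]), and two vertices in one component have a common forward
    image ([fconnect_merge]), so a component contains at most one cycle.  Degrees
    are at most twice those of H because a vertex has degree at most 2 in each
    path; a star on h would be as good for the cycles, but not for the degrees.

    The choices come from Hall's theorem.  For any set of hyperedges, a times
    the number of covered vertices is at least b times the number of hyperedges
    ([sparse_subfamilies]), which is what is needed to give out a copies of
    each vertex, b to a hyperedge.  The cap #|S h i| <= r - 1 is enforced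
    by sending the b units of h through r - 1 gates for each colour.  The gates
    create no new obstruction: closing off all gates of h takes a (r - 1) of
    them, and b <= a (r - 1). *)

Set Implicit Arguments.
Unset Strict Implicit.
Unset Printing Implicit Defensive.

(** * Hall's marriage theorem *)

(** Rado's argument.  If some N x has two elements, one of them can be deleted
    without breaking Hall's condition: otherwise deleting y1 breaks it for some
    x |: X1, with neighbourhood P, and deleting y2 for some x |: X2, with
    neighbourhood Q.  Before the deletions, P :|: Q covers the neighbourhood of
    x |: (X1 :|: X2) and P :&: Q that of X1 :&: X2; as #|P| <= #|X1| and
    #|Q| <= #|X2|, counting gives a contradiction.  When no deletion is possible all N x are
    singletons, and Hall's condition for pairs is injectivity. *)
Theorem hall (A B : finType) (N : A -> {set B}) :
  (forall X : {set A}, #|X| <= #|\bigcup_(x in X) N x|) ->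
  exists2 f : A -> B, injective f & forall x, f x \in N x.
Proof.
have [n] := ubnP (\sum_x #|N x|); elim: n N => // n IH N; rewrite ltnS.
move=> leN hallN.
case: (pickP (fun x => 1 < #|N x|)) => [x gt1|le1]; last first.
  have N1 x : exists y, N x == [set y].
    suff /cards1P[y ->] : #|N x| == 1 by exists y.
    rewrite eqn_leq leqNgt le1 /=.
    by have := hallN [set x]; rewrite big_set1 cards1.
  exists (fun x => xchoose (N1 x)); last first.
    by move=> x; rewrite {2}(eqP (xchooseP (N1 x))) inE.
  move=> x1 x2 eq_y; apply/eqP; apply: contraT => x12.
  have := hallN [set x1; x2]; rewrite cards2 x12 bigcup_setU !big_set1.
  by rewrite (eqP (xchooseP (N1 x1))) (eqP (xchooseP (N1 x2))) eq_y setUid cards1.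
have [y1 [y2 [y1N y2N y12]]] := card_gt1P gt1.
pose shrink y z := if z == x then N x :\ y else N z.
have shrinkW y z : shrink y z \subset N z.
  by rewrite /shrink; case: eqP => // ->; apply: subsetDl.
have hall_shrink y : y \in N x ->
    [forall X : {set A}, #|X| <= #|\bigcup_(z in X) shrink y z|] ->
    exists2 f : A -> B, injective f & forall z, f z \in N z.
  move=> yN /forallP hallS; case: (IH (shrink y)) => // [|f f_inj fS].
    apply: leq_trans leN; rewrite (bigD1 x) // [ltnRHS](bigD1 x) //=.
    rewrite -addSn leq_add //; last by apply: leq_sum => z _; apply: subset_leq_card.
    by rewrite /shrink eqxx [ltnRHS](cardsD1 y) yN.
  by exists f => // z; apply: (subsetP (shrinkW y z)).
have tight y : ~~ [forall X : {set A}, #|X| <= #|\bigcup_(z in X) shrink y z|] ->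
    exists2 X : {set A}, x \notin X &
      #|(\bigcup_(z in X) N z) :|: (N x :\ y)| <= #|X|.
  case/forallPn => X; rewrite -ltnNge => ltX.
  have shrinkE (Y : {set A}) : x \notin Y ->
      \bigcup_(z in Y) shrink y z = \bigcup_(z in Y) N z.
    move=> xY; apply: eq_bigr => z zY; rewrite /shrink.
    by case: eqP => // zx; rewrite -zx zY in xY.
  have xX : x \in X.
    by apply: contraTT ltX => xX; rewrite shrinkE // -leqNgt hallN.
  exists (X :\ x); first by rewrite setD11.
  rewrite -ltnS; move: ltX; rewrite (cardsD1 x X) xX (big_setD1 x) //=.
  by rewrite shrinkE ?setD11 // /shrink eqxx setUC.
have [/(hall_shrink _ y1N)//|/tight[X1 xX1 leX1]] :=
  boolP [forall X : {set A}, #|X| <= #|\bigcup_(z in X) shrink y1 z|].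
have [/(hall_shrink _ y2N)//|/tight[X2 xX2 leX2]] :=
  boolP [forall X : {set A}, #|X| <= #|\bigcup_(z in X) shrink y2 z|].
set P := _ :|: _ in leX1; set Q := _ :|: _ in leX2.
have leU : #|x |: (X1 :|: X2)| <= #|P :|: Q|.
  apply: leq_trans (hallN _) (subset_leq_card _); apply/bigcupsP => z.
  rewrite !inE => /or3P[/eqP->|zX|zX].
  - apply/subsetP => y yN; rewrite !inE yN.
    by case: (eqVneq y y1) => [->|]; rewrite ?y12 ?orbT.
  - apply: subset_trans (subsetUl _ _); apply: subset_trans (subsetUl _ _).
    exact: bigcup_sup.
  - apply: subset_trans (subsetUr _ _); apply: subset_trans (subsetUl _ _).
    exact: bigcup_sup.
have leI : #|X1 :&: X2| <= #|P :&: Q|.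
  apply: leq_trans (hallN _) (subset_leq_card _); apply/bigcupsP => z.
  rewrite inE => /andP[z1 z2]; rewrite subsetI.
  by rewrite !(subset_trans _ (subsetUl _ _)) // (bigcup_sup z).
move: leU; rewrite cardsU1 !inE (negPf xX1) (negPf xX2) /=.
have := cardsUI X1 X2; have := cardsUI P Q; lia.
Qed.

(** * Choosing vertices with a cap per colour *)

Lemma card_set_sum (A B : finType) (X : {set A + B}) :
  #|X| = #|[set u | inl u \in X]| + #|[set w | inr w \in X]|.
Proof.
rewrite -!sum1_card big_sumType /=.
by congr (_ + _); apply: eq_bigl => u; rewrite inE.
Qed.

Lemma card_fibres (A I : finType) (f : A -> I) (X : {set A}) :
  #|X| = \sum_i #|[set x in X | f x == i]|.
Proof.
rewrite -sum1_card (partition_big f xpredT) //=; apply: eq_bigr => i _.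
by rewrite -sum1_card; apply: eq_bigl => x; rewrite inE.
Qed.

(** The contribution of one colour to a times Hall's condition in
    [capped_choice]: n hyperedges have a unit in the family, d have a gate of
    this colour in it, x have both, and the d hyperedges cover v vertices.  The
    difference of the two sides is at least (a s - b) (n - x). *)
Lemma cut_term a b s x d n v :
    b <= a * s -> x <= d -> x <= n -> b * d <= a * v ->
  n * b + a * (x * s) <= n * (a * s) + a * v.
Proof.
move=> leb xd xn dv; rewrite -(subnKC xn).
have := leq_mul leb (leqnn (n - x)).
have : b * x <= b * d by rewrite leq_mul2l xd orbT.
move: (n - x) => m.
rewrite !mulnDl [x * b]mulnC [m * b]mulnC [m * _]mulnC [a * (x * s)]mulnCA.
by clear xd xn; lia.
Qed.

(** An integral flow, obtained from a single matching.  Each h has b units and,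
    for each colour i, s gates; every gate occurs both on the left and on the
    right.  On the left, a unit of h may take the right copy of any gate of h,
    and a gate may take its own right copy (it is then closed) or a pair (v, i)
    with v in inc h, i its colour.  When a unit takes a gate, the left copy of
    that gate has to take a vertex, so the units reach b distinct pairs, at
    most s of them in each colour. *)
Lemma capped_choice (E T : finType) (inc : E -> {set T}) (a b s : nat) :
    0 < a -> b <= a * s ->
    (forall A : {set E}, b * #|A| <= a * #|\bigcup_(h in A) inc h|) ->
  exists S : E -> 'I_a -> {set T},
    [/\ forall h i, S h i \subset inc h,
        forall i h1 h2 v, v \in S h1 i -> v \in S h2 i -> h1 = h2,
        forall h i, #|S h i| <= s
      & forall h, \sum_i #|S h i| = b].
Proof.
move=> a_gt0 leb dense.
pose gate := (E * 'I_a * 'I_s)%type.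
pose N (x : E * 'I_b + gate) : {set gate + T * 'I_a} :=
  match x with
  | inl u => [set y | if y is inl w then w.1.1 == u.1 else false]
  | inr w => [set y | match y with
                      | inl w' => w' == w
                      | inr p => (p.1 \in inc w.1.1) && (p.2 == w.1.2)
                      end]
  end.
have [X|f f_inj fN] := @hall _ _ N.
  (* A: hyperedges with a unit in X; W: gates in X; D i: hyperedges with a gate
     of colour i in X; Q: all gates of hyperedges in A *)
  pose A := [set h | [exists j, inl (h, j) \in X]].
  pose W := [set w | inr w \in X].
  pose D i := [set h | [exists k, (h, i, k) \in W]].
  pose Q := [set w : gate | w.1.1 \in A].
  pose V i := \bigcup_(h in D i) inc h.
  have cardXl : #|[set u | inl u \in X]| <= #|A| * b.
    rewrite -[b in _ * b]card_ord -cardsT -cardsX; apply: subset_leq_card.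
    apply/subsetP => -[h j]; rewrite !inE andbT => hjX.
    by apply/existsP; exists j.
  have cardQ : #|Q| = #|A| * (a * s).
    rewrite -[a in RHS]card_ord -[s in RHS]card_ord -!cardsT -!cardsX.
    pose assoc (p : E * ('I_a * 'I_s)) := (p.1, p.2.1, p.2.2).
    rewrite -(card_imset _ (f := assoc)); last first.
      by move=> [h1 [i1 k1]] [h2 [i2 k2]] [-> -> ->].
    congr #|pred_of_set _|; apply/setP => -[[h i] k]; rewrite inE.
    apply/idP/imsetP => [/= hA|[[h' [i' k']] /=]].
      by exists (h, (i, k)); rewrite // !inE /= in hA *; rewrite hA.
    by rewrite !inE /= !andbT => hA [-> _ _].
  have cardWQ : #|W :&: Q| <= \sum_i #|A :&: D i| * s.
    rewrite (card_fibres (fun w : gate => w.1.2)); apply: leq_sum => i _.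
    rewrite -[s in _ * s]card_ord -cardsT -cardsX.
    apply: leq_trans (leq_imset_card (fun p => (p.1, i, p.2)) _).
    apply: subset_leq_card; apply/subsetP => -[[h i'] k]; rewrite !inE /=.
    move=> /andP[/andP[hW hA] /eqP ii']; subst i'; apply/imsetP; exists (h, k) => //.
    by rewrite !inE /= hA andbT; apply/existsP; exists k; rewrite inE.
  set NX := \bigcup_(x in X) N x.
  have cardNl : #|W :|: Q| <= #|[set w | inl w \in NX]|.
    apply: subset_leq_card; apply/subsetP => w; rewrite !inE => /orP[wX|].
      by apply/bigcupP; exists (inr w); rewrite // inE.
    by case/existsP => j jX; apply/bigcupP; exists (inl (w.1.1, j)); rewrite // inE.
  have cardNr : \sum_i #|V i| <= #|[set p | inr p \in NX]|.
    rewrite [leqRHS](card_fibres (fun p : T * 'I_a => p.2)); apply: leq_sum => i _.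
    rewrite -(card_imset _ (f := fun v => (v, i))); last by move=> v1 v2 [].
    apply: subset_leq_card; apply/subsetP => _ /imsetP[v /bigcupP[h hD vh] ->].
    rewrite !inE eqxx andbT; move: hD; rewrite inE => /existsP[k]; rewrite inE => hX.
    by apply/bigcupP; exists (inr (h, i, k)); rewrite // inE /= vh eqxx.
  have count : #|A| * b + \sum_i #|A :&: D i| * s
               <= #|A| * (a * s) + \sum_i #|V i|.
    (* multiplied by a, both sides become sums over the colours *)
    rewrite -(leq_pmul2l a_gt0) !mulnDr !big_distrr /=.
    have const_sum m : a * m = \sum_(i < a) m by rewrite sum_nat_const card_ord.
    rewrite !(const_sum (_ * _)) -!big_split /=; apply: leq_sum => i _.
    apply: (cut_term leb _ _ (dense (D i))); apply: subset_leq_card.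
      exact: subsetIr.
    exact: subsetIl.
  rewrite (card_set_sum X) (card_set_sum NX).
  rewrite -cardQ in count; rewrite -/W; have := cardsUI W Q.
  move: #|W :|: Q| #|W :&: Q| #|W| #|Q| #|[set u | inl u \in X]| (#|A| * b)
    #|[set w | inl w \in NX]| #|[set p | inr p \in NX]|
    (\sum_i #|A :&: D i| * s) (\sum_i #|V i|) cardXl cardWQ cardNl cardNr count.
  by clear; lia.
(* the pair reached by a unit through its gate *)
have slotP u : exists p, [exists k, (f (inl u) == inl (u.1, p.2, k))
                                 && (f (inr (u.1, p.2, k)) == inr p)].
  have := fN (inl u); case fu: (f (inl u)) => [[[h i] k]|p]; rewrite inE //=.
  move/eqP => hu; subst h; have := fN (inr (u.1, i, k)).
  case fg: (f (inr _)) => [w|[v i']]; rewrite inE /=.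
    (* the gate is already taken by u, so it cannot be closed *)
    move/eqP=> wE; have := f_inj (inl u) (inr (u.1, i, k)).
    by rewrite fu fg wE => /(_ erefl).
  case/andP=> vh /eqP ii'; subst i'; exists (v, i); apply/existsP; exists k.
  by rewrite fg !eqxx.
pose g u := xchoose (slotP u).
have gP u : exists2 k, f (inl u) = inl (u.1, (g u).2, k)
                     & f (inr (u.1, (g u).2, k)) = inr (g u).
  by have /existsP[k /andP[/eqP ? /eqP ?]] := xchooseP (slotP u); exists k.
have g_inj : injective g.
  move=> u1 u2 eq_g; have [k1 f1 e1] := gP u1; have [k2 f2 e2] := gP u2.
  have : f (inr (u1.1, (g u1).2, k1)) = f (inr (u2.1, (g u2).2, k2)).
    by rewrite e1 e2 eq_g.
  case/f_inj => eh _ ek.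
  have [//] : inl u1 = inl u2 :> E * 'I_b + gate.
  by apply: f_inj; rewrite f1 f2 eh eq_g ek.
have g_inc u : (g u).1 \in inc u.1.
  have [k _ fg] := gP u; have := fN (inr (u.1, (g u).2, k)).
  by rewrite fg inE => /andP[].
pose J h i := [set j : 'I_b | (g (h, j)).2 == i].
pose S h i := [set (g (h, j)).1 | j in J h i].
have cardS h i : #|S h i| = #|J h i|.
  apply: card_in_imset => j1 j2; rewrite !inE => /eqP e1 /eqP e2 ev.
  have [//] : (h, j1) = (h, j2).
  by apply: g_inj; apply/eqP; rewrite -pair_eqE /pair_eq ev e1 e2 !eqxx.
exists S; split=> [h i|i h1 h2 v|h i|h].
- by apply/subsetP => _ /imsetP[j _ ->]; apply: g_inc (h, j).
- case/imsetP=> j1; rewrite inE => /eqP e1 ->.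
  case/imsetP=> j2; rewrite inE => /eqP e2 ev.
  have [//] : (h1, j1) = (h2, j2).
  by apply: g_inj; apply/eqP; rewrite -pair_eqE /pair_eq ev e1 e2 !eqxx.
- (* the units of h that reach colour i go through distinct gates *)
  rewrite cardS; have kP j : exists k, f (inl (h, j)) == inl (h, (g (h, j)).2, k).
    by have [k -> _] := gP (h, j); exists k.
  rewrite -(card_in_imset (f := fun j => xchoose (kP j))).
    by rewrite -[leqRHS]card_ord max_card.
  move=> j1 j2; rewrite !inE => /eqP e1 /eqP e2 ek.
  have := eqP (xchooseP (kP j1)); rewrite ek e1 -e2 -(eqP (xchooseP (kP j2))).
  by case/f_inj.
- rewrite -[RHS]card_ord -cardsT (card_fibres (fun j => (g (h, j)).2)).
  by apply: eq_bigr => i _; rewrite cardS; apply: eq_card => j; rewrite !inE.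
Qed.

(** * Graphs of self-maps *)

Section FunctionalGraphs.
Variable T : finType.
Implicit Types (f : T -> T) (W : {set T}) (l c : seq T) (C G : hypergraph T).

(** Fixed points of f give no edge, so a total f also encodes graphs in which
    some vertices start no arc.  Edges that would leave W are dropped, which
    makes [fgraph] a hypergraph for all f and W. *)
Definition arc_edges f W : {set {set T}} :=
  [set e in [set [set x; f x] | x in W & f x != x] | e \subset W].

Lemma fgraph_wf f W : wf_hypergraph (W, arc_edges f W).
Proof. by apply/forall_inP => e; rewrite inE => /andP[]. Qed.

Definition fgraph f W : hypergraph T := Hypergraph (fgraph_wf f W).

Lemma fgraph_edgeP f W e :
  reflect (exists x, [/\ x \in W, f x \in W, f x != x & e = [set x; f x]])
          (e \in edges (fgraph f W)).
Proof.
rewrite inE; apply: (iffP andP) => [[/imsetP[x]]|[x [xW fxW fx ->]]].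
  rewrite inE => /andP[xW fx] ->; rewrite subUset !sub1set => /andP[_ fxW].
  by exists x.
rewrite subUset !sub1set xW fxW; split=> //.
by apply/imsetP; exists x; rewrite // inE xW fx.
Qed.

Lemma fgraph_uniform2 f W : uniform 2 (fgraph f W).
Proof.
apply/forall_inP => e /fgraph_edgeP[x [_ _ fx ->]].
by rewrite cards2 [x == _]eq_sym fx.
Qed.

Lemma eq_set2 (x y u v : T) :
  [set x; y] = [set u; v] -> x = u /\ y = v \/ x = v /\ y = u.
Proof.
move=> E; have other (s t w : T) : [set s; t] = [set s; w] -> t = w.
  move/setP => E'; have := E' w; have := E' t; rewrite !inE !eqxx !orbT.
  by case: eqP => [->|_ /esym/eqP//] _; rewrite orbb => /eqP->.
have : x \in [set u; v] by rewrite -E set21.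
rewrite !inE => /orP[/eqP xu|/eqP xv]; [left|right]; split=> //.
  by apply: (other x); rewrite E xu.
by apply: (other x); rewrite E xv setUC.
Qed.

Lemma next2_neq c x : uniq c -> 2 < size c -> x \in c -> next c (next c x) != x.
Proof.
move=> c_uniq c_gt2 xc; case: (rot_to xc) => i s rotc.
rewrite -!(next_rot i c_uniq) rotc; move: c_uniq c_gt2.
rewrite -(rot_uniq i) -(size_rot i) rotc; case: s {rotc} => [|y [|z s]] //=.
rewrite !inE !negb_or eqxx => /andP[/and3P[xy xz _] _] _.
by rewrite [y == x]eq_sym (negPf xy) eqxx eq_sym.
Qed.

(** Let c list the vertices of the cycle.  Each edge of it is an arc of f,
    pointing forwards or backwards along c.  The two neighbours of x on the cycle
    are distinct and f is single-valued, so a forward arc at x excludes a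
    backward arc from x to its predecessor, and the arc that precedes it is
    forward as well; hence all arcs are forward, or all are backward, and f runs
    through c or through its reversal. *)
Lemma fgraph_cycle f W C :
    is_cycle C -> subgraph C (fgraph f W) ->
  exists c, [/\ fcycle f c, 0 < size c, {in c, forall x, f x != x},
    vset C = [set x in c] & edges C = [set [set x; f x] | x in c]].
Proof.
case=> c [c_uniq c_gt2 vC eC] /andP[_ subC].
have arc x : x \in c ->
    f x = next c x /\ f x != x \/ f (next c x) = x /\ f (next c x) != next c x.
  move=> xc; have : [set x; next c x] \in edges C.
    by rewrite eC; apply/imsetP; exists x.
  move/(subsetP subC)/fgraph_edgeP => [y [_ _ fy /eq_set2[] [e1 e2]]].
    by left; rewrite e2 e1.
  by right; rewrite e2 e1.
have oriented d : [set [set x; next d x] | x in d] = edges C ->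
    d =i c -> uniq d -> {in d, forall x, f x = next d x /\ f x != x} ->
  exists c, [/\ fcycle f c, 0 < size c, {in c, forall x, f x != x},
    vset C = [set x in c] & edges C = [set [set x; f x] | x in c]].
  move=> eC' dc d_uniq arc_d; exists d; split=> //.
  - by apply: cycle_from_next => // x /arc_d[/eqP].
  - rewrite lt0n size_eq0; apply: contraTneq c_gt2 => d0.
    by case: (c) dc => // x s /(_ x); rewrite d0 !inE eqxx.
  - by move=> x /arc_d[].
  - by rewrite vC; apply/setP => x; rewrite !inE dc.
  - by rewrite -eC'; apply: eq_in_imset => x /arc_d[->].
have [/hasP[x0 x0c /andP[/eqP e0 n0]]|/hasPn bwd] :=
    boolP (has (fun x => (f x == next c x) && (f x != x)) c).
  apply: (oriented c) => // y yc.
  (* induction on the number of steps from y forwards to x0 *)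
  have : fconnect (next c) y x0 by rewrite (fconnect_cycle (cycle_next c_uniq)).
  move/iter_findex; move: (findex _ _ _) => m.
  elim: m y yc => [|n IHn] y yc; first by move=> /= ->.
  rewrite iterSr => /(IHn _ _)[|en _]; first by rewrite mem_next.
  case: (arc _ yc) => [//|[e' _]].
  by have := next2_neq c_uniq c_gt2 yc; rewrite -en e' eqxx.
have fprev x : x \in c -> f x = prev c x /\ f x != x.
  move=> xc; have pc : prev c x \in c by rewrite mem_prev.
  case: (arc _ pc) => [[e n]|]; last by rewrite next_prev.
  by have := bwd _ pc; rewrite n andbT e eqxx.
apply: (oriented (rev c)); rewrite ?rev_uniq //.
- rewrite eC; apply/setP => e; apply/imsetP/imsetP => -[x].
    rewrite mem_rev => xc ->; exists (prev c x); first by rewrite mem_prev.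
    by rewrite next_rev // next_prev // setUC.
  move=> xc ->; exists (next c x); first by rewrite mem_rev mem_next.
  by rewrite next_rev // prev_next // setUC.
- by move=> x; rewrite mem_rev.
- by move=> x; rewrite mem_rev => /fprev[-> ?]; rewrite next_rev.
Qed.

(** Along an edge one end is the image of the other, so the two ends of a walk
    keep a common forward image as the walk grows. *)
Lemma fconnect_merge f W x y :
    connect (adj (fgraph f W)) x y ->
  exists2 z, fconnect f x z & fconnect f y z.
Proof.
case/connectP => p; elim: p x => [|u p IH] x /= => [_ ->|/andP[/andP[_]]].
  by exists x.
case/fgraph_edgeP => v [_ _ _ /eq_set2 xu] up /(IH _ up) [z uz yz].
case: xu => -[-> eu]; rewrite eu in uz.
  by exists z => //; apply: connect_trans (fconnect1 _ _) uz.
exists (f z); last exact: connect_trans yz (fconnect1 _ _).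
by case/iter_findex: uz => <-; rewrite -iterS iterSr fconnect_iter.
Qed.

Lemma fconnect_confluent f x y z :
    fconnect f x y -> fconnect f x z ->
  exists2 t, fconnect f y t & fconnect f z t.
Proof.
move=> /iter_findex <- /iter_findex <-.
move: (findex f x y) (findex f x z) => m n; exists (iter (m + n) f x).
  by rewrite addnC iterD fconnect_iter.
by rewrite iterD fconnect_iter.
Qed.

(** A cycle is closed under f and is the forward orbit of each of its vertices.
    Two cycles in one component have a vertex in common, namely a common forward
    image of a vertex of each, and so both are its orbit. *)
Lemma fgraph_component_unicyclic f W K :
  is_component (fgraph f W) K -> at_most_one_cycle K.
Proof.
case=> r _ KE C1 C2 cC1 sC1 cC2 sC2.
have sKG : subgraph K (fgraph f W).
  rewrite KE /subgraph subsetIl /=; apply/subsetP => e.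
  by rewrite inE => /andP[].
have sG C : subgraph C K -> subgraph C (fgraph f W).
  case/andP: sKG => sv se /andP[sv' se'].
  by rewrite /subgraph (subset_trans sv') // (subset_trans se').
have to_r C x : subgraph C K -> x \in vset C ->
    exists2 z, fconnect f r z & fconnect f x z.
  case/andP=> /subsetP sv _ /sv; rewrite KE !inE => /andP[_].
  exact: fconnect_merge.
have [c1 [cyc1 n1 nf1 v1 e1]] := fgraph_cycle cC1 (sG _ sC1).
have [c2 [cyc2 n2 nf2 v2 e2]] := fgraph_cycle cC2 (sG _ sC2).
suff c12 : c1 =i c2.
  have ev : vset C1 = vset C2 by rewrite v1 v2; apply/setP => x; rewrite !inE c12.
  have ee : edges C1 = edges C2.
    rewrite e1 e2; apply/setP => e.
    by apply/imsetP/imsetP => -[x xc ->]; exists x; rewrite // ?c12 // -c12.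
  apply: val_inj; rewrite [LHS]surjective_pairing [RHS]surjective_pairing.
  exact: (congr2 pair ev ee).
have [x xc1] : exists x, x \in c1.
  by case: (c1) n1 => // x s _; exists x; rewrite mem_head.
have [y yc2] : exists y, y \in c2.
  by case: (c2) n2 => // y s _; exists y; rewrite mem_head.
have [|u ru xu] := to_r _ x sC1; first by rewrite v1 inE.
have [|v rv yv] := to_r _ y sC2; first by rewrite v2 inE.
have [z uz vz] := fconnect_confluent ru rv.
have zc1 : z \in c1 by rewrite -(fconnect_cycle cyc1 xc1) (connect_trans xu).
have zc2 : z \in c2 by rewrite -(fconnect_cycle cyc2 yc2) (connect_trans yv).
by move=> t; rewrite -(fconnect_cycle cyc1 zc1) (fconnect_cycle cyc2 zc2).
Qed.

(** On a cycle, f would move the vertex of largest rank to one of larger rank. *)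
Lemma fgraph_ranked_forest f W (rank : T -> nat) :
  (forall x, f x != x -> rank x < rank (f x)) -> is_forest (fgraph f W).
Proof.
move=> rank_lt; split=> [|C cC]; first exact: fgraph_uniform2.
apply/negP => sC; have [c [cyc n nf _ _]] := fgraph_cycle cC sC.
case: c n cyc nf => // x0 s _ cyc nf.
have [x xc maxx] :=
  @arg_maxnP _ x0 (fun x => x \in x0 :: s) rank (mem_head x0 s).
have fxc : f x \in x0 :: s by rewrite -(fconnect_cycle cyc xc) fconnect1.
by have := leq_trans (rank_lt _ (nf _ xc)) (maxx _ fxc); rewrite ltnn.
Qed.

(** * Paths as graphs of self-maps *)

(** The last entry of l and everything outside l are fixed, thanks to the
    default value of nth. *)
Definition step l x := nth x l (index x l).+1.

Lemma step_out l x : x \notin l -> step l x = x.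
Proof. by move=> xl; rewrite /step nth_default // memNindex. Qed.

Lemma step_index l x :
  uniq l -> step l x != x -> index (step l x) l = (index x l).+1.
Proof.
move=> l_uniq; rewrite /step; case: (ltnP (index x l).+1 (size l)) => [lt _|ge].
  by rewrite index_uniq.
by rewrite nth_default ?eqxx.
Qed.

Lemma step_mem l x : x \in l -> step l x \in l.
Proof.
move=> xl; rewrite /step; case: (ltnP (index x l).+1 (size l)) => [lt|ge].
  exact: mem_nth.
by rewrite nth_default.
Qed.

Lemma step_forest l W : uniq l -> is_forest (fgraph (step l) W).
Proof.
move=> l_uniq; apply: (@fgraph_ranked_forest _ _ (index^~ l)) => x.
by move/(step_index l_uniq)->.
Qed.

Lemma step_rcons_neq s z x :
  uniq (rcons s z) -> (step (rcons s z) x != x) = (x \in s).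
Proof.
move=> l_uniq; have zs : z \notin s by move: l_uniq; rewrite rcons_uniq => /andP[].
case: (boolP (x \in s)) => xs.
  have lt : (index x (rcons s z)).+1 < size (rcons s z).
    by rewrite size_rcons ltnS -cats1 index_cat xs index_mem.
  apply/eqP => /(congr1 (index^~ (rcons s z))) /=.
  by rewrite /step index_uniq // => /esym/n_Sn.
apply/negbTE; rewrite negbK; case: (eqVneq x z) => [->|xz]; last first.
  by rewrite step_out // mem_rcons inE negb_or xz.
by rewrite /step nth_default // size_rcons -cats1 index_cat (negPf zs) /= eqxx addn0.
Qed.

Lemma step_card_edges s z W :
    uniq (rcons s z) -> {subset rcons s z <= W} ->
  #|edges (fgraph (step (rcons s z)) W)| = size s.
Proof.
set l := rcons s z => l_uniq lW.
have -> : edges (fgraph (step l) W) = [set [set x; step l x] | x in s].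
  apply/setP => e; apply/fgraph_edgeP/imsetP => [[x [_ _ nx ->]]|[x xs ->]].
    by exists x; rewrite // -(step_rcons_neq _ l_uniq).
  have xl : x \in l by rewrite mem_rcons inE xs orbT.
  by exists x; rewrite lW // lW ?step_mem // step_rcons_neq.
rewrite card_in_imset.
  by apply/card_uniqP; move: l_uniq; rewrite rcons_uniq => /andP[].
(* two arcs on one edge would have to be opposite, but indices increase *)
move=> x y xs ys /eq_set2[] [e1 e2] //.
have nx : step l x != x by rewrite step_rcons_neq.
have ny : step l y != y by rewrite step_rcons_neq.
by have := step_index l_uniq nx; have := step_index l_uniq ny; rewrite e2 -e1; lia.
Qed.

Lemma step_degree l W v : uniq l -> degree (fgraph (step l) W) v <= 2.
Proof.
move=> l_uniq; pose u := nth v l (index v l).-1.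
apply: leq_trans (_ : #|[set [set v; step l v]; [set u; v]]| <= 2); last first.
  by rewrite cards2; case: eqP.
apply: subset_leq_card; apply/subsetP => e.
rewrite inE => /andP[/fgraph_edgeP[x [_ _ nx ->]]].
rewrite !inE => /orP[/eqP->|/eqP vE]; first by rewrite eqxx.
suff -> : u = x by rewrite vE eqxx orbT.
rewrite /u {2}vE step_index //= nth_index //.
by apply: contraR nx => xl; rewrite step_out.
Qed.

End FunctionalGraphs.

(** * The decomposition *)

Lemma card_bigcup_leq (I T : finType) (P : pred I) (F : I -> {set T}) (k : nat) :
  (forall i, P i -> #|F i| <= k) -> #|\bigcup_(i | P i) F i| <= #|P| * k.
Proof.
move=> Fk; apply: leq_trans (_ : \sum_(i | P i) #|F i| <= _).
  elim/big_rec2: _ => [|i X m _ leX]; first by rewrite cards0.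
  by apply: leq_trans (leq_of_leqif (leq_card_setU _ _)) _; rewrite leq_add2l.
by rewrite -sum_nat_const; apply: leq_sum.
Qed.

Lemma sparse_subfamilies (T : finType) (H : hypergraph T) (r a b : nat)
    (A : {set {set T}}) :
    0 < r -> 0 < b -> uniform r H ->
    (max_density H <= a%:R / b%:R :> rat)%R ->
    A \subset edges H ->
  b * #|A| <= a * #|cover A|.
Proof.
move=> r_gt0 b_gt0 Hr Hm AH; case: (set_0Vmem A) => [->|[h0 h0A]].
  by rewrite cards0 muln0.
have wfK : wf_hypergraph (cover A, A) by apply/forall_inP => h hA; apply: bigcup_sup.
pose K := Hypergraph wfK.
have sK : subgraph K H.
  rewrite /subgraph AH andbT; apply/bigcupsP => h /(subsetP AH).
  exact: (forall_inP (hgvalP H)).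
have V_gt0 : 0 < #|cover A|.
  have h0_gt0 : 0 < #|h0| by rewrite (eqP (forall_inP Hr _ (subsetP AH _ h0A))).
  by apply: leq_trans h0_gt0 _; apply: subset_leq_card; apply: bigcup_sup.
have : (#|A|%:R / #|cover A|%:R <= a%:R / b%:R :> rat)%R.
  apply: Order.POrderTheory.le_trans Hm.
  apply: (Order.TotalTheory.le_bigmax_cond _ (j := K)
    (fun L : hypergraph T => #|edges L|%:R / #|vset L|%:R)%R).
  by rewrite sK -card_gt0.
rewrite Num.Theory.ler_pdivrMr ?Num.Theory.ltr0n // GRing.mulrAC.
rewrite Num.Theory.ler_pdivlMr ?Num.Theory.ltr0n // -!GRing.natrM Num.Theory.ler_nat.
by rewrite mulnC.
Qed.

Theorem lemma2p1 (T : finType) (r : nat) (H : hypergraph T) (a b : nat)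
  (hr : 2 <= r)
  (Hr : uniform r H)
  (Hm : (max_density H <= a%:R / b%:R :> rat)%R)
  (hb : r - 1 < b)
  (ha : (b%:R / (r - 1)%:R < a%:R :> rat)%R) :
  exists Hs : 'I_a -> hypergraph T,
    [/\ forall i, uniform 2 (Hs i) /\ vset (Hs i) = vset H,
        forall i,
          (forall K, is_component (Hs i) K -> at_most_one_cycle K) /\
          max_degree (Hs i) <= 2 * max_degree H
      & forall h, h \in edges H ->
          exists F : 'I_a -> hypergraph T,
            (forall i, [/\ is_forest (F i), vset (F i) = h
                         & subgraph (F i) (Hs i)]) /\
            \sum_(i < a) #|edges (F i)| = b].
Proof.
have b_gt0 : 0 < b by apply: leq_ltn_trans hb.
have lt_ba : b < a * (r - 1).
  move: ha; rewrite Num.Theory.ltr_pdivrMr ?Num.Theory.ltr0n ?subn_gt0 //.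
  by rewrite -GRing.natrM Num.Theory.ltr_nat.
have a_gt0 : 0 < a by case: (a) lt_ba.
pose E := {h : {set T} | h \in edges H}.
have [A|S [S_sub S_disj S_card S_sum]] :=
  @capped_choice E T val a b (r - 1) a_gt0 (ltnW lt_ba).
  rewrite -(card_imset A val_inj) -[\bigcup_(h in A) _](big_imset id (in2W val_inj)).
  apply: (sparse_subfamilies (ltnW hr) b_gt0 Hr Hm).
  by apply/subsetP => _ /imsetP[h _ ->]; apply: valP.
have card_h (h : E) : #|val h| = r by apply/eqP/(forall_inP Hr)/valP.
have h_sub (h : E) : val h \subset vset H by apply: (forall_inP (hgvalP H)); apply: valP.
have endP h i : exists z, z \in val h :\: S h i.
  apply/set0Pn; rewrite -card_gt0 cardsD (setIidPr (S_sub h i)) card_h.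
  by have := S_card h i; lia.
pose z h i := xchoose (endP h i).
(* the last entry is the end of the path, which starts no arc *)
pose trail h i := rcons (enum (S h i)) (z h i).
have zP h i : z h i \in val h /\ z h i \notin S h i.
  by have := xchooseP (endP h i); rewrite inE => /andP[].
have trail_uniq h i : uniq (trail h i).
  by rewrite rcons_uniq enum_uniq mem_enum (zP h i).2.
have trail_sub h i : {subset trail h i <= val h}.
  move=> v; rewrite mem_rcons inE mem_enum => /orP[/eqP->|].
    by case: (zP h i).
  exact: (subsetP (S_sub h i)).
have trail_step h i v : (step (trail h i) v != v) = (v \in S h i).
  by rewrite (step_rcons_neq _ (trail_uniq h i)) mem_enum.
pose phi i v :=
  if [pick h | v \in S h i] is Some h then step (trail h i) v else v.
have phiE h i v : v \in S h i -> phi i v = step (trail h i) v.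
  move=> vS; rewrite /phi; case: pickP => [h' /S_disj/(_ vS) -> //|/(_ h)].
  by rewrite vS.
pose F h i := fgraph (step (trail h i)) (val h).
exists (fun i => fgraph (phi i) (vset H)); split=> [i|i|h0 h0H].
- by split=> //; apply: fgraph_uniform2.
- split; first exact: fgraph_component_unicyclic.
  apply/bigmax_leqP => v vH.
  apply: leq_trans (_ : 2 * degree H v <= _); last first.
    by rewrite leq_mul2l /= leq_bigmax_cond.
  have -> : degree H v = #|[pred h : E | v \in val h]|.
    rewrite /degree -[RHS](card_imset _ val_inj); apply: eq_card => h; rewrite inE.
    apply/andP/imsetP => [[hH vh]|[h' vh' ->]]; first by exists (Sub h hH).
    by split=> //; apply: valP.
  rewrite mulnC.
  (* an edge of H_i at v is an edge of F h i at v, for some h through v *)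
  pose near h := [set e in edges (F h i) | v \in e].
  apply: leq_trans (card_bigcup_leq (F := near) (k := 2) _); last first.
    by move=> h _; apply: step_degree.
  apply: subset_leq_card; apply/subsetP => e.
  rewrite inE => /andP[/fgraph_edgeP[x [_ _ nx ->]] ve].
  have [h xS] : exists h, x \in S h i.
    by move: nx; rewrite /phi; case: pickP => [h xS _|_]; [exists h|rewrite eqxx].
  have xl : x \in trail h i by rewrite mem_rcons inE mem_enum xS orbT.
  have sxl := step_mem xl.
  apply/bigcupP; exists h.
    by move: ve; rewrite !inE (phiE h i) // => /orP[]/eqP->; apply: (trail_sub h i).
  rewrite inE ve andbT; apply/fgraph_edgeP; exists x.
  by rewrite (phiE h i) // trail_step; split=> //; apply: (trail_sub h i).
- pose h : E := Sub h0 h0H; exists (F h); split=> [i|]; last first.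
    rewrite -(S_sum h); apply: eq_bigr => i _.
    by rewrite (step_card_edges (trail_uniq h i) (@trail_sub h i)) cardE.
  split=> //; first exact: step_forest.
  apply/andP; split; first exact: h_sub.
  apply/subsetP => e /fgraph_edgeP[x [xh sxh nx ->]].
  apply/fgraph_edgeP; exists x; rewrite (phiE h) -?trail_step //.
  by split=> //; apply: (subsetP (h_sub h)).
Qed.
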